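(* Let $n\ge 1$ and let $A\in\mathcal{M}_n$ be a real $n\times n$ matrix. Then the problem $$\operatorname*{argmin}_{U\in\mathcal{K}^{\mathrm{sq}}_n}\|U-A\|_F$$ admits a solution; that is, there exists $U_0\in\mathcal{K}^{\mathrm{sq}}_n$ such that $\|U_0-A\|_F\le\|U-A\|_F$ for every $U\in\mathcal{K}^{\mathrm{sq}}_n$.
   Context: $\mathcal{M}_n$ is the space of real $n\times n$ matrices with the Frobenius inner product $\langle X,Y\rangle_F=\sum_{i=1}^n\sum_{j=1}^n X_{ij}Y_{ij}$ and induced norm $\|X\|_F=\sqrt{\langle X,X\rangle_F}$. $\mathcal{K}_n\subset\mathcal{M}_n$ is the subspace of real skew-symmetric matrices, and $\mathcal{K}^{\mathrm{sq}}_n=\{K^2 : K\in\mathcal{K}_n\}$. *)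

(* Defs.v *)
From mathcomp Require Import all_boot all_order all_algebra.
From mathcomp Require Import all_classical all_reals.

Set Implicit Arguments.
Unset Strict Implicit.
Unset Printing Implicit Defensive.

Import Order.TTheory GRing.Theory Num.Theory.

Local Open Scope classical_set_scope.
Local Open Scope ring_scope.

Definition frob_inner (R : realType) (n : nat) (X Y : 'M[R]_n) : R :=
  \sum_i \sum_j X i j * Y i j.

Definition frob_norm (R : realType) (n : nat) (X : 'M[R]_n) : R :=
  Num.sqrt (frob_inner X X).

(* [skewmx] is membership K = (-1) ^+ true *: map_mx idfun K^T, i.e. K = - K^T. *)
Definition skew_set (R : realType) (n : nat) : set 'M[R]_n :=
  [set K : 'M[R]_n | K \is skewmx].

Arguments skew_set : clear implicits.

(* [*m] is used for the square since ['M_n] is an [nzRingType] only when [n] is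
   syntactically a successor. *)
Definition skew_sq (R : realType) (n : nat) : set 'M[R]_n :=
  [set K *m K | K in skew_set R n].
Arguments skew_sq : clear implicits.

(* Main.v *)
Require Import Defs.
From mathcomp Require Import all_boot all_order all_algebra.
From mathcomp Require Import all_classical all_reals.
From mathcomp Require Import ring lra.
From mathcomp Require Import topology normedtype derive realfun.

(** The squaring map [K |-> K^2] is continuous, so only the unboundedness of
    the space of skew-symmetric matrices stands between the problem and the
    extreme value theorem.  Skew-symmetry supplies the missing coercivity: since
    [K^T = - K], the squared Frobenius norm of [K] is [- \tr (K^2)], so [K] is
    controlled by the diagonal of [K^2] ([skew_entry_sq_le]).

    The zero matrix is a candidate, at distance [frob_norm A] from [A].  A
    candidate [K^2] that does at least as well has entries of absolute value at
    most [2 * frob_norm A], hence the entries of [K] lie in a fixed segment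
    ([skew_entry_bounded]).  The distance from [K^2] to [A] has a minimum over a
    compact set of matrices [K] that contains zero and all of these, and this
    minimum is global because every other [K] does worse than zero.

    Skew-symmetric matrices are parametrised linearly as [L - L^T], where [L] is
    an arbitrary matrix unfolded into a row vector: the search domain is then a
    plain box, which is compact. *)

Import Order.TTheory GRing.Theory Num.Theory.
Import numFieldNormedType.Exports.

Local Open Scope classical_set_scope.
Local Open Scope ring_scope.

(** * Skew-symmetric matrices *)

Lemma skew_setP {R : realType} {n : nat} (K : 'M[R]_n) :
  skew_set R n K <-> forall i j, K i j = - K j i.
Proof.
rewrite /skew_set /= qualifE /= expr1 scaleN1r; split.
- by move=> /eqP KE i j; rewrite {1}KE !mxE.
- by move=> KE; apply/eqP/matrixP => i j; rewrite !mxE /= KE.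
Qed.

(** A linear parametrisation of the skew-symmetric matrices; its argument is a
    row vector because compactness of boxes is a statement about row vectors. *)
Definition skew_of_row {R : realType} {n : nat} (v : 'rV[R]_(n * n)) : 'M[R]_n :=
  vec_mx v - (vec_mx v)^T.

Lemma skew_of_row_skew {R : realType} {n : nat} (v : 'rV[R]_(n * n)) :
  skew_set R n (skew_of_row v).
Proof. by apply/skew_setP => i j; rewrite !mxE opprB. Qed.

Lemma skew_of_rowK {R : realType} {n : nat} {K : 'M[R]_n} :
  skew_set R n K -> skew_of_row (mxvec (2^-1 *: K)) = K.
Proof.
move=> /skew_setP KE; apply/matrixP => i j.
by rewrite /skew_of_row mxvecK !mxE (KE j i); field.
Qed.

(** * Frobenius norm *)

Lemma sqr_entry_le_frob_inner {R : realType} {n : nat} (X : 'M[R]_n) i j :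
  X i j ^+ 2 <= frob_inner X X.
Proof.
rewrite /frob_inner (bigD1 i) //= (bigD1 j) //= -expr2 -addrA lerDl.
by apply: addr_ge0; do ?[apply: sumr_ge0 => ? _]; rewrite -expr2 sqr_ge0.
Qed.

Lemma norm_entry_le_frob_norm {R : realType} {n : nat} (X : 'M[R]_n) i j :
  `|X i j| <= frob_norm X.
Proof. by rewrite -sqrtr_sqr; apply/ler_wsqrtr/sqr_entry_le_frob_inner. Qed.

Lemma frob_normN {R : realType} {n : nat} (X : 'M[R]_n) :
  frob_norm (- X) = frob_norm X.
Proof.
congr Num.sqrt; apply: eq_bigr => i _; apply: eq_bigr => j _.
by rewrite !mxE mulrNN.
Qed.

(** * Coercivity of squaring on skew-symmetric matrices *)

(** The term [K i j ^+ 2] of the norm is minus the term [K i j * K j i] of the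
    trace: this is where skew-symmetry rules out cancellation, whereas a large
    matrix can in general have a small square. *)
Lemma frob_inner_skew {R : realType} {n : nat} (K : 'M[R]_n) :
  skew_set R n K -> frob_inner K K = - \tr (K *m K).
Proof.
move=> /skew_setP KE; rewrite /frob_inner /mxtrace -sumrN.
apply: eq_bigr => i _; rewrite mxE -sumrN; apply: eq_bigr => j _.
by rewrite (KE j i) mulrN opprK.
Qed.

Lemma skew_entry_sq_le {R : realType} {n : nat} {K : 'M[R]_n} i j :
  skew_set R n K -> K i j ^+ 2 <= \sum_k `|(K *m K) k k|.
Proof.
move=> Kskew; apply: le_trans (sqr_entry_le_frob_inner _ _ _) _.
rewrite frob_inner_skew //; apply: le_trans (ler_norm _) _.
by rewrite normrN; exact: ler_norm_sum.
Qed.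

(** Each of the [n] diagonal entries of [K *m K] is at most [2 * frob_norm A] in
    absolute value, by the triangle inequality through [A]. *)
Lemma skew_entry_bounded {R : realType} {n : nat} {A K : 'M[R]_n} i j :
  skew_set R n K -> frob_norm (K *m K - A) <= frob_norm A ->
  `|K i j| <= Num.sqrt (n%:R * (2 * frob_norm A)).
Proof.
move=> Kskew Knear; rewrite -sqrtr_sqr; apply: ler_wsqrtr.
apply: le_trans (skew_entry_sq_le i j Kskew) _.
rewrite mulr_natl -[n in _ *+ n]card_ord -sumr_const; apply: ler_sum => k _.
have -> : (K *m K) k k = (K *m K - A) k k + A k k by rewrite !mxE subrK.
apply: le_trans (ler_normD _ _) _; rewrite mulr2n mulrDl mul1r.
by apply: lerD; [apply: le_trans Knear|]; exact: norm_entry_le_frob_norm.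
Qed.

(** * Existence of a minimiser *)

Lemma sum_continuous {R : realType} {T : topologicalType} {I : finType}
    (f : I -> T -> R) :
  (forall i, continuous (f i)) -> continuous (fun x => \sum_i f i x).
Proof. by move=> fc; apply: continuous_big => //; exact: add_continuous. Qed.

Lemma dist_skew_of_row_continuous {R : realType} {n : nat} (A : 'M[R]_n) :
  continuous (fun v : 'rV[R]_(n * n) =>
    frob_norm (skew_of_row v *m skew_of_row v - A)).
Proof.
have vecc i j : continuous (fun v : 'rV[R]_(n * n) => vec_mx v i j).
  by under eq_fun do rewrite mxE; exact: coord_continuous.
have entryc i j : continuous (fun v : 'rV[R]_(n * n) => skew_of_row v i j).
  have E v : skew_of_row v i j = vec_mx v i j - vec_mx v j i by rewrite !mxE.
  under eq_fun do rewrite E.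
  by move=> v; apply: continuousB; [exact: (vecc i j v) | exact: (vecc j i v)].
have distc i j : continuous (fun v : 'rV[R]_(n * n) =>
    (skew_of_row v *m skew_of_row v - A) i j).
  have E (K : 'M[R]_n) : (K *m K - A) i j = \sum_k K i k * K k j - A i j.
    by rewrite !mxE.
  under eq_fun do rewrite E.
  move=> v; apply: continuousB; last exact: cst_continuous.
  by apply: sum_continuous => k u; apply: continuousM; exact: entryc.
pose D v := skew_of_row v *m skew_of_row v - A.
move=> v; apply: (@continuous_comp _ _ _ (fun u => frob_inner (D u) (D u))).
  2: exact: sqrt_continuous.
apply: sum_continuous => i; apply: sum_continuous => j u.
by apply: continuousM; exact: distc.
Qed.

Theorem proposition1 (R : realType) (n : nat) (hn : (1 <= n)%N) (A : 'M[R]_n) :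
  exists U0 : 'M[R]_n, skew_sq R n U0 /\
    forall U : 'M[R]_n, skew_sq R n U -> frob_norm (U0 - A) <= frob_norm (U - A).
Proof.
set b := Num.sqrt (n%:R * (2 * frob_norm A)).
pose box := [set v : 'rV[R]_(n * n) | forall k, `[- b, b]%classic (v ord0 k)].
have box0 : box 0 by move=> k /=; rewrite mxE in_itv /= oppr_le0 sqrtr_ge0.
have box_compact : compact box.
  apply: (@rV_compact _ _ (fun=> `[- b, b]%classic)) => _.
  exact: segment_compact.
have [v0 _ v0min] := compact_EVT_min (ex_intro _ _ box0) box_compact
  (continuous_subspaceT (dist_skew_of_row_continuous A)).
exists (skew_of_row v0 *m skew_of_row v0); split.
  by exists (skew_of_row v0) => //; exact: skew_of_row_skew.
move=> _ [K Kskew <-].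
(* [frob_norm A] is the distance reached by the row vector 0, which is in the
   box. *)
have [Knear|/ltW Kfar] := leP (frob_norm (K *m K - A)) (frob_norm A); last first.
  apply: le_trans Kfar; have := v0min 0 (mem_set box0).
  by rewrite /skew_of_row linear0 trmx0 subrr mul0mx sub0r frob_normN.
(* The row representing [K] lists the entries of [K / 2], so it is in the box. *)
rewrite -(skew_of_rowK Kskew); apply: v0min; apply/mem_set => k /=.
rewrite in_itv /= -ler_norml; case/mxvec_indexP: k => i j.
rewrite mxvecE mxE normrM; apply: le_trans (skew_entry_bounded i j Kskew Knear).
by rewrite ler_piMl // ger0_norm //; lra.
Qed.
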